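(* Let $\Gamma$ be a finite simple graph with at least one vertex and let $G$ be the right-angled Artin group with defining graph $\Gamma$. Then the geodesic exponential growth rate $\beta(G)$ of $G$ with respect to its standard symmetric set of generators $\{v : v\in V\Gamma\}\cup\{v^{-1} : v\in V\Gamma\}$ is either equal to $1$ or a Perron number.
   Context: The right-angled Artin group defined by a simple graph $\Gamma$ with vertex set $V\Gamma$ and edge set $E\Gamma$ is the group with presentation $$G=\langle v\in V\Gamma \mid [u,v]=1 \text{ if } (u,v)\in E\Gamma\rangle .$$ Its standard symmetric generating set is $S=\{v : v\in V\Gamma\}\cup\{v^{-1} : v\in V\Gamma\}$. Let $b_l$ be the number of geodesic paths of length $l$ in the Cayley graph of $G$ with respect to $S$ starting at the identity, where a geodesic path is a path joining two given vertices and having the minimal number of edges. (Equivalently, $b_l$ is the number of words of length $l$ over $S$ that are of minimal length among all words over $S$ representing the same group element.) The geodesic exponential growth rate of $G$ with respect to $S$ is $\beta(G)=\limsup_{l\to\infty}\sqrt[l]{b_l}$. A Perron number is a real algebraic integer bigger than $1$ which is strictly greater in absolute value than any of its other Galois conjugates. *)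

(* Defs.v *)
From HB Require Import structures.
From mathcomp Require Import all_boot all_order all_algebra.
From mathcomp Require Import finmap generic_quotient.
From mathcomp Require Import all_classical all_reals all_analysis.
From mathcomp Require Import complex.

Set Implicit Arguments.
Unset Strict Implicit.
Unset Printing Implicit Defensive.

Import Order.TTheory GRing.Theory Num.Theory.

Local Open Scope classical_set_scope.
Local Open Scope quotient_scope.

(* The group < X | rels >.  In a word, the letter (x, false) stands for the
   generator x and (x, true) for its formal inverse. *)
Section PresentedGroup.
Variables (X : choiceType) (rels : set (seq (X * bool))).
Implicit Types (u v w : seq (X * bool)).

Inductive word_eq : seq (X * bool) -> seq (X * bool) -> Prop :=
| word_eq_refl w : word_eq w w
| word_eq_sym u v : word_eq u v -> word_eq v u
| word_eq_trans u v w : word_eq u v -> word_eq v w -> word_eq u w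
| word_eq_cancel u v x b : word_eq (u ++ [:: (x, b); (x, ~~ b)] ++ v) (u ++ v)
| word_eq_rel u v r : rels r -> word_eq (u ++ r ++ v) (u ++ v).

Definition word_eqb : rel (seq (X * bool)) := fun u v => `[< word_eq u v >].

Lemma word_eqbP u v : reflect (word_eq u v) (word_eqb u v).
Proof. exact: asboolP. Qed.

Lemma word_eqb_refl : reflexive word_eqb.
Proof. by move=> w; apply/word_eqbP/word_eq_refl. Qed.

Lemma word_eqb_sym : symmetric word_eqb.
Proof. by move=> u v; apply/word_eqbP/word_eqbP; apply: word_eq_sym. Qed.

Lemma word_eqb_trans : transitive word_eqb.
Proof.
move=> v u w /word_eqbP uv /word_eqbP vw.
exact/word_eqbP/(word_eq_trans uv vw).
Qed.

Canonical word_eq_equiv :=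
  EquivRel word_eqb word_eqb_refl word_eqb_sym word_eqb_trans.

Definition presented_group := {eq_quot word_eq_equiv}.

HB.instance Definition _ := Choice.on presented_group.
HB.instance Definition _ := EqQuotient.on presented_group.

Lemma pi_word_eq u v :
  \pi_presented_group u = \pi_presented_group v <-> word_eq u v.
Proof. by split=> [/eqmodP /word_eqbP|/word_eqbP uv] //; apply/eqmodP. Qed.

Lemma word_eq_cat u u' v v' :
  word_eq u u' -> word_eq v v' -> word_eq (u ++ v) (u' ++ v').
Proof.
move=> uu' vv'; apply: (@word_eq_trans _ (u' ++ v)).
  elim: uu' v {vv'} => {u u'}
    [w|u w _ IH|u v w _ IH1 _ IH2|u w x b|u w r rr] z.
  - exact: word_eq_refl.
  - exact/word_eq_sym/IH.
  - exact: word_eq_trans (IH1 z) (IH2 z).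
  - by rewrite -!catA; apply: word_eq_cancel.
  - by rewrite -!catA; apply: word_eq_rel.
elim: vv' u' {uu'} => {v v'}
  [w|u1 w _ IH|u1 v w _ IH1 _ IH2|u1 w x b|u1 w r rr] z.
- exact: word_eq_refl.
- exact/word_eq_sym/IH.
- exact: word_eq_trans (IH1 z) (IH2 z).
- by rewrite !(catA z); apply: word_eq_cancel.
- by rewrite !(catA z); apply: word_eq_rel.
Qed.

Definition word_inv w : seq (X * bool) := rev [seq (a.1, ~~ a.2) | a <- w].

Lemma word_inv_cat u v : word_inv (u ++ v) = word_inv v ++ word_inv u.
Proof. by rewrite /word_inv map_cat rev_cat. Qed.

Lemma word_invK : involutive word_inv.
Proof.
move=> w; rewrite /word_inv map_rev revK -map_comp -[RHS]map_id.
by apply: eq_map => -[x b] /=; rewrite negbK.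
Qed.

Lemma word_mulV w : word_eq (w ++ word_inv w) [::].
Proof.
elim: w => [|[x b] w IH]; first exact: word_eq_refl.
rewrite -cat1s word_inv_cat -catA [w ++ _ ++ _]catA.
apply: (@word_eq_trans _ ([:: (x, b)] ++ [::] ++ word_inv [:: (x, b)])).
  by do 2?[apply: word_eq_cat => //; try exact: word_eq_refl].
exact: (@word_eq_cancel [::] [::] x b).
Qed.

Lemma word_mulVw w : word_eq (word_inv w ++ w) [::].
Proof. by rewrite -{2}(word_invK w); apply: word_mulV. Qed.

Lemma word_eq_inv u v : word_eq u v -> word_eq (word_inv u) (word_inv v).
Proof.
move=> uv; apply: (@word_eq_trans _ (word_inv u ++ (v ++ word_inv v))).
  rewrite -{1}[word_inv u]cats0; apply: word_eq_cat; first exact: word_eq_refl.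
  exact/word_eq_sym/word_mulV.
rewrite catA -[X in word_eq _ X]cat0s.
apply: word_eq_cat; last exact: word_eq_refl.
apply: word_eq_trans (word_mulVw u).
by apply: word_eq_cat; [exact: word_eq_refl | exact: word_eq_sym].
Qed.

Definition pg_one : presented_group := \pi_presented_group [::].
Definition pg_mul (g h : presented_group) : presented_group :=
  \pi_presented_group (repr g ++ repr h).
Definition pg_inv (g : presented_group) : presented_group :=
  \pi_presented_group (word_inv (repr g)).

Lemma word_eq_repr w : word_eq (repr (\pi_presented_group w)) w.
Proof. by apply/pi_word_eq; rewrite reprK. Qed.

Lemma pg_mul_pi u v :
  pg_mul (\pi_presented_group u) (\pi_presented_group v)
  = \pi_presented_group (u ++ v).
Proof. by apply/pi_word_eq/word_eq_cat; apply: word_eq_repr. Qed.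

Lemma pg_inv_pi u :
  pg_inv (\pi_presented_group u) = \pi_presented_group (word_inv u).
Proof. by apply/pi_word_eq/word_eq_inv/word_eq_repr. Qed.

Lemma presented_groupW (P : presented_group -> Prop) :
  (forall w, P (\pi_presented_group w)) -> forall g, P g.
Proof. by move=> Pw g; rewrite -[g]reprK. Qed.

Lemma pg_mulA : associative pg_mul.
Proof.
elim/presented_groupW=> u; elim/presented_groupW=> v.
by elim/presented_groupW=> w; rewrite !pg_mul_pi catA.
Qed.

Lemma pg_mul1g : left_id pg_one pg_mul.
Proof. by elim/presented_groupW=> u; rewrite pg_mul_pi. Qed.

Lemma pg_mulg1 : right_id pg_one pg_mul.
Proof. by elim/presented_groupW=> u; rewrite pg_mul_pi cats0. Qed.

Lemma pg_mulVg : left_inverse pg_one pg_inv pg_mul.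
Proof.
by elim/presented_groupW=> u; rewrite pg_inv_pi pg_mul_pi; apply/pi_word_eq/word_mulVw.
Qed.

Lemma pg_mulgV : right_inverse pg_one pg_inv pg_mul.
Proof.
by elim/presented_groupW=> u; rewrite pg_inv_pi pg_mul_pi; apply/pi_word_eq/word_mulV.
Qed.

HB.instance Definition _ := isGroup.Build presented_group
  pg_mulA pg_mul1g pg_mulg1 pg_mulVg pg_mulgV.

Lemma pg_pi_cat u v :
  \pi_presented_group (u ++ v) =
  (\pi_presented_group u * \pi_presented_group v)%g.
Proof. exact/esym/pg_mul_pi. Qed.

Lemma pg_pi_inv u :
  \pi_presented_group (word_inv u) = ((\pi_presented_group u)^-1)%g.
Proof. exact/esym/pg_inv_pi. Qed.

Definition pg_gen (x : X) : presented_group :=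
  \pi_presented_group [:: (x, false)].

End PresentedGroup.

Section RightAngledArtin.
Variables (V : finType) (e : rel V).

(* The words u v u^-1 v^-1 for the edges (u, v). *)
Definition raag_rels : set (seq (V * bool)) :=
  [set w | exists u v : V,
     e u v /\ w = [:: (u, false); (v, false); (u, true); (v, true)]].

Definition raag := presented_group raag_rels.
HB.instance Definition _ := Group.on raag.

Definition raag_gens : set raag :=
  [set g | exists v : V,
     g = pg_gen raag_rels v \/ g = ((pg_gen raag_rels v : raag)^-1)%g].

End RightAngledArtin.

Section GeodesicGrowth.
Variables (G : groupType) (S : set G).

Definition cayley : rel G := [rel g h | (g^-1 * h)%g \in S].

(* As in path, p lists the vertices following the initial vertex g, so that
   size p is the number of edges. *)
Definition geodesic_path (g : G) (p : seq G) : Prop :=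
  path cayley g p /\
  forall q : seq G, path cayley g q -> last g q = last g p ->
    (size p <= size q)%N.

(* fset_set is meaningful only on finite sets, so this is the number of
   geodesics when S is finite. *)
Definition num_geodesics (l : nat) : nat :=
  #|` fset_set [set p : seq G | size p = l /\ geodesic_path 1%g p] |%fset.

(* For finite S the sequence is bounded, so the real-valued limn_sup is the
   genuine limit superior. *)
Definition geodesic_growth_rate (R : realType) : R :=
  limn_sup (fun l : nat => ((num_geodesics l)%:R `^ (l%:R^-1))%R : R).

End GeodesicGrowth.

Section Perron.
Local Open Scope ring_scope.
Local Open Scope complex_scope.
Variable R : realType.

Definition minimal_poly (x : R) (p : {poly rat}) : Prop :=
  [/\ p \is monic, root (map_poly ratr p) x &
      forall q : {poly rat}, q != 0 -> root (map_poly ratr q) x ->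
        (size p <= size q)%N].

Definition galois_conjugate (x : R) (z : R[i]) : Prop :=
  exists2 p : {poly rat}, minimal_poly x p & root (map_poly ratr p) z.

Definition perron_number (x : R) : Prop :=
  [/\ 1 < x, integralOver (intr : int -> R) x &
      forall z : R[i], galois_conjugate x z -> z != x%:C -> `|z| < `|x%:C|].

End Perron.

(* Main.v *)
Require Import Defs.
From mathcomp Require Import all_boot all_order all_algebra.
From mathcomp Require Import finmap complex lra.
From mathcomp Require Import all_classical all_reals all_analysis.

Set Implicit Arguments.
Unset Strict Implicit.
Unset Printing Implicit Defensive.

Import Order.TTheory GRing.Theory Num.Theory.
Import numFieldNormedType.Exports.

(** The number of geodesics of length l is a path count in a finite weighted
    graph, and the growth rate is the Perron eigenvalue of its matrix.

    To recognise geodesic words, let G act on pilings: each vertex carries a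
    stack of signed or blank beads, and a letter x of vertex v either pushes
    a signed bead on the stack of v and a blank one on every stack whose vertex
    does not commute with v, or, if the top of the stack of v is the inverse of
    x, undoes such a push.  This respects the relations of G
    ([foldl_act_word_eq]), and the number of signed beads grows by at most one
    per letter.  Hence a word all of whose letters push is geodesic; conversely,
    the first letter that pops cancels against an earlier one
    ([top_last_letter]), so the word can be shortened.

    Whether a letter pushes depends only on the tops of the stacks.  Forgetting
    signs, the state is the set s of vertices with a signed bead on top; the
    letters of vertex v send it to {v} together with the neighbours of v in s,
    one sign being allowed if v is in s and both otherwise.  So the number of
    geodesics is a column sum of the l-th power of a natural number matrix
    indexed by sets of vertices ([num_geodesicsE], [colsum_transfer]).

    Two properties of this automaton replace an analysis of its strongly
    connected components, that is, of the decomposition of G as a direct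
    product.  First, the numbers of continuations from any two states differ by
    a factor of at most 2 ^ #|V| ([num_words_comparable]): enlarging a state
    only forbids signs, and each added vertex does so only up to its first
    occurrence.  Second, any word in which every vertex occurs leads all states
    to one and the same state ([enum_synchronizes]), so a power of the matrix
    has a row without zeros.

    The rest is a Perron-Frobenius argument from these two properties
    ([perron_colsum_growth]).  Comparability makes the column sums both
    submultiplicative and supermultiplicative up to a constant, hence equal to
    lam ^ l up to a constant ([growth_constant]).  Cesaro means of the column
    sums divided by lam ^ l then accumulate at a positive eigenvector h
    ([positive_eigenvector]).  Finally, subtracting from the n-th power of the
    matrix a small multiple of h in its positive row leaves a nonnegative matrix
    of spectral radius mu < lam ^ n, which for an eigenvalue z other than lam
    still has the eigenvalue z ^ n, unless z ^ n is equal to mu; so every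
    eigenvalue z distinct from lam satisfies |z| < lam
    ([subdominant_eigenvalue]).  As lam is a root of the characteristic
    polynomial, which is monic with integer coefficients, it is an algebraic
    integer, and its Galois conjugates are eigenvalues. *)

(** * The action of the group on pilings *)
Section Pilings.
Variables (V : finType) (e : rel V).
Hypotheses (e_sym : symmetric e) (e_irr : irreflexive e).
Implicit Types (x y : V * bool) (w : seq (V * bool)) (u v : V).

(** [Some b] is a bead with the sign of the letter [(v, b)], [None] a blank
    bead. *)
Definition piling := {ffun V -> seq (option bool)}.
Implicit Types P Q : piling.

Definition piling0 : piling := [ffun => [::]].
Definition push x P : piling :=
  [ffun u => if e x.1 u then P u
             else (if u == x.1 then Some x.2 else None) :: P u].
Definition pop v P : piling :=
  [ffun u => if e v u then P u else behead (P u)].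
Definition top P v : option bool := head None (P v).
Definition act P x : piling :=
  if top P x.1 == Some (~~ x.2) then pop x.1 P else push x P.

(** Only pilings built by pushes carry an action of the group: on an arbitrary
    piling a pop could remove a signed bead from a neighbouring stack. *)
Inductive valid : piling -> Prop :=
| valid0 : valid piling0
| valid_push x P :
    valid P -> top P x.1 != Some (~~ x.2) -> valid (push x P).

Lemma top_push_other x P u : u != x.1 ->
  top (push x P) u = if e x.1 u then top P u else None.
Proof. by move=> /negPf ux; rewrite /top ffunE ux; case: ifP. Qed.

Lemma top_push_self x P : top (push x P) x.1 = Some x.2.
Proof. by rewrite /top ffunE e_irr eqxx. Qed.

(** A bead pushed after the blank ones that accompany a signed bead would have
    put a blank bead on top of the latter, unless it commutes with it.  So all
    the beads that a pop has to remove are accessible. *)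
Lemma valid_blank P v b u : valid P -> top P v = Some b ->
  u != v -> ~~ e v u -> P u = None :: behead (P u).
Proof.
move=> vP; elim: vP v b u => [|x Q vQ IH hx] v b u.
  by rewrite /top ffunE.
have [->|xv] := eqVneq v x.1.
  by rewrite ffunE => _ /negPf -> /negPf ->.
rewrite top_push_other //; case: ifP => // exv tQ uv evu.
rewrite ffunE; case: ifP => [_|exu /=]; first exact: IH tQ uv evu.
case: eqP => // ux; by rewrite ux e_sym exv in evu.
Qed.

(** Needed for a letter to be pushed back after its inverse was popped. *)
Lemma valid_reduced P v b : valid P -> top P v = Some b ->
  head None (behead (P v)) != Some (~~ b).
Proof.
move=> vP; elim: vP v b => [|x Q vQ IH hx] v b.
  by rewrite /top ffunE.
have [->|xv] := eqVneq v x.1.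
  by rewrite top_push_self => -[<-]; rewrite ffunE e_irr.
rewrite top_push_other //; case: ifP => // exv tQ.
by rewrite ffunE exv; apply: IH.
Qed.

Lemma pop_push x P : pop x.1 (push x P) = P.
Proof. by apply/ffunP=> u; rewrite !ffunE; case: (e x.1 u). Qed.

Lemma push_pop x P : valid P -> top P x.1 = Some x.2 ->
  push x (pop x.1 P) = P.
Proof.
move=> vP tP; apply/ffunP=> u; rewrite !ffunE; case: (boolP (e x.1 u)) => // eu.
have [->|ux] := eqVneq u x.1; last by rewrite -(valid_blank vP tP ux eu).
by move: tP; rewrite /top; case: (P x.1) => [|a s] /= => [|->].
Qed.

(** The stacks touched by both operations have a blank bead on top, so it does
    not matter whether that bead or the one being pushed is removed. *)
Lemma push_popC x P v b : valid P -> top P v = Some b -> e x.1 v ->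
  push x (pop v P) = pop v (push x P).
Proof.
move=> vP tP exv; apply/ffunP=> u; rewrite !ffunE.
case: (boolP (e x.1 u)) => exu; case: (boolP (e v u)) => evu //=.
have [ux|ux] := eqVneq u x.1; first by rewrite ux e_sym exv in evu.
rewrite -(valid_blank vP tP _ evu) //.
by apply: contraNneq exu => ->.
Qed.

Lemma pushC x y P : e x.1 y.1 -> push x (push y P) = push y (push x P).
Proof.
move=> exy; apply/ffunP=> u; rewrite !ffunE.
have [->|ux] := eqVneq u x.1; first by rewrite e_irr e_sym exy.
have [->|uy] := eqVneq u y.1; first by rewrite e_irr exy.
by case: ifP; case: ifP.
Qed.

Lemma popC u v P : pop u (pop v P) = pop v (pop u P).
Proof. by apply/ffunP=> a; rewrite !ffunE; case: ifP; case: ifP. Qed.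

Lemma top_pop_adj u v P : e v u -> top (pop v P) u = top P u.
Proof. by rewrite /top ffunE => ->. Qed.

Lemma top_push_adj x u P : e x.1 u -> top (push x P) u = top P u.
Proof. by rewrite /top ffunE => ->. Qed.

(** The popped bead commutes with all the beads pushed after its own push, so
    the pop can be moved back to cancel that push. *)
Lemma valid_pop P v b : valid P -> top P v = Some b -> valid (pop v P).
Proof.
move=> vP; elim: vP v b => [|x Q vQ IH hx] v b; first by rewrite /top ffunE.
have [->|xv] := eqVneq v x.1; first by rewrite pop_push.
rewrite top_push_other //; case: ifP => // exv tQ.
rewrite -(push_popC vQ tQ exv); apply: valid_push; first exact: IH tQ.
by rewrite top_pop_adj // e_sym.
Qed.

Lemma valid_act P x : valid P -> valid (act P x).
Proof.
move=> vP; rewrite /act; case: eqP => [tP|/eqP tP].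
  exact: valid_pop tP.
exact: valid_push.
Qed.

Lemma valid_foldl P w : valid P -> valid (foldl act P w).
Proof. by elim: w P => //= x w IH P vP; apply/IH/valid_act. Qed.

Lemma act_cancel P v b : valid P -> act (act P (v, b)) (v, ~~ b) = P.
Proof.
move=> vP; rewrite {2}/act /=; case: eqP => [tP|/eqP tP].
  rewrite /act /= negbK ifN ?(push_pop (x := (v, ~~ b))) //.
  have := valid_reduced vP tP; rewrite negbK; apply: contraNN.
  by rewrite /top ffunE e_irr.
by rewrite /act /= negbK (top_push_self (v, b)) eqxx (pop_push (v, b)).
Qed.

Lemma actC P x y : valid P -> e x.1 y.1 ->
  act (act P x) y = act (act P y) x.
Proof.
move=> vP exy; have eyx : e y.1 x.1 by rewrite e_sym.
rewrite /act; case: (boolP (top P x.1 == _)) => tx;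
  case: (boolP (top P y.1 == _)) => ty;
  rewrite ?(top_pop_adj _ exy) ?(top_push_adj _ exy)
    ?(top_pop_adj _ eyx) ?(top_push_adj _ eyx)
    ?(eqP tx) ?(eqP ty) ?(negPf tx) ?(negPf ty) ?eqxx.
- exact: popC.
- exact: push_popC vP (eqP tx) eyx.
- by rewrite (push_popC vP (eqP ty) exy).
- exact/esym/pushC.
Qed.

Local Notation weq := (word_eq (raag_rels e)).

Lemma foldl_act_word_eq w w' : weq w w' ->
  forall P, valid P -> foldl act P w = foldl act P w'.
Proof.
elim=> {w w'}
  [//|u v _ IH|u v w _ IH1 _ IH2|u v x b|u v r [a [c [eac ->]]]] P vP.
- by rewrite IH.
- by rewrite IH1 ?IH2.
- by rewrite !foldl_cat /= act_cancel //; apply: valid_foldl.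
- rewrite !foldl_cat /=; congr foldl; set Q := foldl _ _ _.
  have vQ : valid Q by apply: valid_foldl.
  have va x R : valid R -> valid (act R x) by apply: valid_act.
  have eca : e c a by rewrite e_sym.
  rewrite (@actC _ (c, false) (a, true)) //; last exact: va.
  by rewrite (@act_cancel Q a false) // (@act_cancel Q c false).
Qed.

Definition beads P : nat := \sum_v count isSome (P v).

Lemma beads_push x P : beads (push x P) = (beads P).+1.
Proof.
rewrite /beads (bigD1 x.1) //= [in RHS](bigD1 x.1) //=.
rewrite ffunE e_irr eqxx /= add1n addSn; congr (_ + _).+1.
by apply: eq_bigr => v /negPf vx; rewrite ffunE vx; case: ifP.
Qed.

Lemma beads_pop v P : (beads (pop v P) <= beads P)%N.
Proof.
apply: leq_sum => u _; rewrite ffunE; case: ifP => // _.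
by case: (P u) => //= a s; apply: leq_addl.
Qed.

Lemma beads_foldl w P : (beads (foldl act P w) <= beads P + size w)%N.
Proof.
elim: w P => [|x w IH] P /=; first by rewrite addn0.
apply: leq_trans (IH _) _; rewrite -addSnnS leq_add2r /act.
by case: ifP => _; rewrite ?beads_push // (leq_trans (beads_pop _ _)).
Qed.

Fixpoint pushing P w : bool :=
  if w is x :: w' then (top P x.1 != Some (~~ x.2)) && pushing (push x P) w'
  else true.

Lemma pushing_rcons P w x : pushing P (rcons w x) =
  pushing P w && (top (foldl act P w) x.1 != Some (~~ x.2)).
Proof.
elim: w P => [|y w IH] P /=; first by rewrite andbT.
rewrite IH -andbA; case: (boolP (top _ _ != _)) => //= /negPf ty.
by rewrite /act ty.
Qed.

Lemma pushing_beads P w : pushing P w ->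
  beads (foldl act P w) = (beads P + size w)%N.
Proof.
elim: w P => [|x w IH] P /=; first by rewrite addn0.
move=> /andP[/negPf tx /IH]; rewrite /act tx => ->.
by rewrite beads_push addSnnS.
Qed.

(** The number of signed beads is an invariant of the group element which bounds
    the length of every word from below, with equality if no letter pops. *)
Lemma pushing_minimal w w' :
  pushing piling0 w -> weq w w' -> (size w <= size w')%N.
Proof.
move=> pw ww'; have b0 : beads piling0 = 0%N.
  by rewrite /beads big1 // => v _; rewrite ffunE.
have := pushing_beads pw; rewrite (foldl_act_word_eq ww' valid0) b0 add0n => <-.
by have := beads_foldl w' piling0; rewrite b0.
Qed.

(** The relations only say that the generators commute; inverses are reached by
    conjugation. *)
Lemma word_eq_swap x y : e x.1 y.1 -> weq [:: x; y] [:: y; x].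
Proof.
have can z (u v : seq (V * bool)) :
    weq (u ++ [:: (z.1, z.2); (z.1, ~~ z.2)] ++ v) (u ++ v).
  exact: word_eq_cancel.
have canV z (u v : seq (V * bool)) :
    weq (u ++ [:: (z.1, ~~ z.2); (z.1, z.2)] ++ v) (u ++ v).
  by have := @word_eq_cancel _ (raag_rels e) u v z.1 (~~ z.2); rewrite negbK.
have conj x' y' : weq [:: x'; y'] [:: y'; x'] ->
    weq [:: x'; (y'.1, ~~ y'.2)] [:: (y'.1, ~~ y'.2); x'].
  case: y' => v b h /=.
  apply: word_eq_trans (word_eq_sym (canV (v, b) [::] [:: x'; (v, ~~ b)])) _.
  apply: (@word_eq_trans _ _ _
      ([:: (v, ~~ b)] ++ [:: x'; (v, b)] ++ [:: (v, ~~ b)])).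
    apply: (@word_eq_cat _ _ [:: (v, ~~ b)] _
      ([:: (v, b); x'] ++ [:: (v, ~~ b)])).
      exact: word_eq_refl.
    exact: word_eq_cat (word_eq_sym h) (word_eq_refl _ _).
  exact: (can (v, b) [:: (v, ~~ b); x'] [::]).
have base a c : e a c ->
    weq [:: (a, false); (c, false)] [:: (c, false); (a, false)].
  move=> eac; apply: word_eq_sym.
  have r : weq ([:: (a, false); (c, false); (a, true); (c, true)] ++
      [:: (c, false); (a, false)]) [:: (c, false); (a, false)].
    apply: (@word_eq_rel _ _ [::] [:: (c, false); (a, false)]
      [:: (a, false); (c, false); (a, true); (c, true)]).
    by exists a, c.
  apply: word_eq_trans (word_eq_sym r) _.
  apply: word_eq_trans
    (canV (c, false) [:: (a, false); (c, false); (a, true)] [:: (a, false)]) _.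
  exact: (canV (a, false) [:: (a, false); (c, false)] [::]).
case: x y => a p [c q] /= eac.
have h1 : weq [:: (a, false); (c, q)] [:: (c, q); (a, false)].
  by case: q; [apply: (conj _ (c, false)) |]; apply: base.
case: p => //; apply: word_eq_sym; apply: (conj _ (a, false)).
exact: word_eq_sym.
Qed.

(** A letter whose bead is on top commutes with all the later ones, so it can be
    moved to the end of the word. *)
Lemma top_last_letter w v b : pushing piling0 w ->
  top (foldl act piling0 w) v = Some b ->
  exists2 w', weq w (rcons w' (v, b)) & size w = (size w').+1.
Proof.
elim/last_ind: w v b => [|w x IH] v b; first by rewrite /top ffunE.
rewrite pushing_rcons foldl_rcons => /andP[pw tx]; rewrite /act (negPf tx).
have [->|vx] := eqVneq v x.1.
  rewrite top_push_self => -[<-]; exists w; last by rewrite size_rcons.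
  by rewrite -surjective_pairing; apply: word_eq_refl.
rewrite top_push_other //; case: ifP => // exv tP.
have [w' ww' sw] := IH v b pw tP; exists (rcons w' x); last first.
  by rewrite !size_rcons sw.
rewrite -!cats1 in ww' *.
apply: word_eq_trans (word_eq_cat ww' (word_eq_refl _ _)) _.
rewrite -!catA; apply: word_eq_cat (word_eq_refl _ _) _.
by apply: word_eq_swap; rewrite e_sym.
Qed.

Lemma not_pushing_shorten w : ~~ pushing piling0 w ->
  exists2 w', weq w w' & (size w' < size w)%N.
Proof.
elim/last_ind: w => [//|w x IH].
rewrite pushing_rcons negb_and; case: (boolP (pushing _ w)) => [pw|npw _] //=.
  rewrite negbK => /eqP tx.
  have [w' ww' sw] := top_last_letter pw tx; exists w'; last first.
    by rewrite size_rcons sw leqW.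
  rewrite -!cats1 in ww' *.
  apply: word_eq_trans (word_eq_cat ww' (word_eq_refl _ _)) _.
  rewrite -catA; have := @word_eq_cancel _ (raag_rels e) w' [::] x.1 (~~ x.2).
  by rewrite negbK -surjective_pairing !cats0.
have [w' ww' sw] := IH npw; exists (rcons w' x); last by rewrite !size_rcons.
by rewrite -!cats1; apply: word_eq_cat ww' (word_eq_refl _ _).
Qed.

Lemma pushingP w :
  pushing piling0 w <-> forall w', weq w w' -> (size w <= size w')%N.
Proof.
split=> [pw w'|min]; first exact: pushing_minimal.
apply/negPn/negP => /not_pushing_shorten[w' /min].
by rewrite leqNgt => /negPf ->.
Qed.


(** * Counting geodesics by the set of exposed vertices *)

Definition tops P : {set V} := [set v | isSome (top P v)].
(** [s] stands for [tops P].  Pushing a bead on the stack of [v] hides the tops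
    of all the stacks that do not commute with [v]. *)
Definition step (s : {set V}) v : {set V} := v |: (s :&: [set u | e v u]).
(** The number of signs with which [v] can be pushed: if its stack shows a sign,
    the opposite one is excluded. *)
Definition weight (s : {set V}) v : nat := if v \in s then 1 else 2.

Fixpoint num_words (s : {set V}) l : nat :=
  if l is l'.+1 then \sum_v weight s v * num_words (step s v) l' else 1.

Lemma tops_push x P : tops (push x P) = step (tops P) x.1.
Proof.
apply/setP=> u; rewrite !inE; have [->|ux] := eqVneq u x.1.
  by rewrite top_push_self.
by rewrite top_push_other //; case: (e _ _); rewrite ?andbT ?andbF.
Qed.

(** A recursive enumeration, so that the count of geodesic words inherits the
    recursion of [num_words]. *)
Fixpoint words l : seq (seq (V * bool)) :=
  if l is l'.+1 then [seq x :: w | x <- enum {: V * bool}, w <- words l']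
  else [:: [::]].

Lemma mem_words l w : (w \in words l) = (size w == l).
Proof.
elim: l w => [|l IH] [|x w] //=.
  by apply/negP => /allpairsP[[y u] [_ _]].
apply/allpairsP/eqP => [[[y u] [_ /= uw [_ ->]]]|[sw]].
  by move: uw; rewrite IH => /eqP ->.
by exists (x, w); rewrite mem_enum IH sw eqxx.
Qed.

Lemma uniq_words l : uniq (words l).
Proof.
elim: l => //= l IH; apply: allpairs_uniq; rewrite ?enum_uniq //.
by move=> [x u] [y w] _ _ /= [-> ->].
Qed.

Lemma count_pushing l P : count (pushing P) (words l) = num_words (tops P) l.
Proof.
elim: l P => [|l IH] P //=.
rewrite count_flatten sumnE !big_map -enumT big_enum /=.
transitivity (\sum_v \sum_b
    (top P v != Some (~~ b)) * num_words (step (tops P) v) l).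
  rewrite pair_bigA; apply: eq_bigr => -[v b] _ /=; rewrite count_map.
  rewrite -(tops_push (v, b)) -IH -[RHS]/(_ * _)%N.
  rewrite (eq_count (a2 := fun w =>
    (top P v != Some (~~ b)) && pushing (push (v, b) P) w)) //.
  case: (_ != _); rewrite ?mul1n // mul0n; exact: count_pred0.
apply: eq_bigr => v _; rewrite big_bool /= -mulnDl; congr (_ * _)%N.
by rewrite /weight inE; case: (top P v) => [[]|].
Qed.

Definition letter x : raag e := \pi_(presented_group (raag_rels e))%qT [:: x].

Fixpoint walk (g : raag e) w : seq (raag e) :=
  if w is x :: w' then (g * letter x)%g :: walk (g * letter x)%g w' else [::].

Lemma size_walk g w : size (walk g w) = size w.
Proof. by elim: w g => //= x w IH g; rewrite IH. Qed.

Lemma last_walk g w :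
  last g (walk g w) = (g * \pi_(presented_group (raag_rels e))%qT w)%g.
Proof.
elim: w g => [|x w IH] g /=; first by rewrite [RHS]pg_mulg1.
by rewrite IH -mulgA -cat1s pg_pi_cat.
Qed.

Lemma letter_gens (g : raag e) :
  (g \in @raag_gens V e) <-> exists x, g = letter x.
Proof.
have letterV v : letter (v, true) = ((pg_gen (raag_rels e) v : raag e)^-1)%g.
  by rewrite /pg_gen -pg_pi_inv.
rewrite inE; split=> [[v [->|->]]|[[v b] ->]].
- by exists (v, false).
- by exists (v, true); rewrite letterV.
- by exists v; case: b; [right; rewrite letterV|left].
Qed.

(** Without this, two words could give the same path: the generators and their
    inverses are distinct in G because they act differently on the empty
    piling. *)
Lemma letter_inj : injective letter.
Proof.
move=> x y /pi_word_eq /foldl_act_word_eq /(_ _ valid0) /=.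
have act0 z : act piling0 z = push z piling0 by rewrite /act /top ffunE.
rewrite !act0 => /ffunP/(_ x.1); rewrite !ffunE e_irr eqxx.
case: (e _ _) => //; case: eqP => // + [+].
by case: x y => [a b] [c d] /= -> ->.
Qed.

(** A path determines the quotients of its consecutive vertices, hence the
    letters along it. *)
Lemma walk_inj g : injective (walk g).
Proof.
move=> w; elim: w g => [|x w IH] g [|y w'] //= [/mulgI/letter_inj ->].
by move/IH => ->.
Qed.

Lemma walkP g p : path (cayley (@raag_gens V e)) g p <-> exists w, p = walk g w.
Proof.
split=> [|[w ->]]; last first.
  elim: w g => //= x w IH g; rewrite IH andbT /cayley /= mulKg.
  by apply/letter_gens; exists x.
elim: p g => [|h p IH] g /=; first by exists [::].
case/andP => /letter_gens[x hx] /IH[w ->].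
by exists (x :: w) => /=; rewrite -hx mulgA mulgV mul1g.
Qed.

Lemma geodesic_walkP w :
  geodesic_path (@raag_gens V e) 1%g (walk 1%g w) <-> pushing piling0 w.
Proof.
split=> [[_ geo]|/pushingP min].
  apply/pushingP=> w' /pi_word_eq ww'.
  rewrite -(size_walk 1%g w) -(size_walk 1%g w'); apply: geo.
    by apply/walkP; exists w'.
  by rewrite !last_walk ww'.
split=> [|q /walkP[w' ->]]; first by apply/walkP; exists w.
rewrite !last_walk => /mulgI/pi_word_eq/word_eq_sym/min.
by rewrite !size_walk.
Qed.

Lemma num_geodesicsE l :
  num_geodesics (@raag_gens V e) l = num_words finset.set0 l.
Proof.
pose geo := [seq walk 1%g w | w <- words l & pushing piling0 w].
have -> : finset.set0 = tops piling0.
  by apply/setP => v; rewrite !inE /top ffunE.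
rewrite -count_pushing /num_geodesics.
rewrite (_ : [set p | _] = [set` [fset p in geo]%fset])%classic; last first.
  apply/seteqP; split=> p /=.
    case=> sp gp.
    have [w pw] : exists w, p = walk 1%g w by apply/walkP; case: gp.
    rewrite inE /geo; apply/mapP; exists w => //.
    rewrite mem_filter mem_words -(size_walk 1%g) -pw sp eqxx andbT.
    by apply/geodesic_walkP; rewrite -pw.
  rewrite inE => /mapP[w]; rewrite mem_filter mem_words.
  case/andP=> /geodesic_walkP gw /eqP sw ->; by rewrite size_walk.
rewrite set_fsetK card_fseq undup_id ?map_inj_uniq ?filter_uniq ?uniq_words //.
  by rewrite size_map size_filter.
exact: walk_inj.
Qed.

End Pilings.

Local Open Scope classical_set_scope.
Local Open Scope ring_scope.

(** * Spectral estimates for nonnegative matrices *)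
Lemma eigen_expmx (F : comNzRingType) k (B : 'M[F]_k) (x : 'rV_k) z n :
  x *m B = z *: x -> x *m B ^+ n = z ^+ n *: x.
Proof.
move=> xB; elim: n => [|n IH]; first by rewrite expr0 mulmx1 scale1r.
by rewrite exprS -mulmxE mulmxA xB -scalemxAl IH scalerA -exprS.
Qed.

(** In the supremum norm weighted by the positive eigenvector [h], a nonnegative
    matrix has operator norm [mu]. *)
Lemma eigen_norm_le (F : numFieldType) k (N : 'M[F]_k) (h y : 'rV_k)
    (w mu : F) :
  (forall j i, 0 <= N j i) -> (forall i, 0 < h 0 i) -> h *m N = mu *: h ->
  y *m N = w *: y -> y != 0 -> `|w| <= mu.
Proof.
move=> N0 h0 hN yN y0.
have [i0 yi0] : exists i, y 0 i != 0.
  apply/existsP; apply: contraNT y0; rewrite negb_exists => /forallP y0.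
  by apply/eqP/rowP => i; rewrite mxE; apply/eqP/negPn/y0.
have hV i : 0 < (h 0 i)^-1 by rewrite invr_gt0.
have Freal : {in xpredT, forall i, `|y 0 i| / h 0 i \is Num.real}.
  by move=> i _; rewrite ger0_real // mulr_ge0 // ltW.
case: (real_arg_maxP (i0 := i0) isT Freal) => i _ imax.
set K := `|y 0 i| / h 0 i.
have K0 : 0 < K.
  by apply: lt_le_trans (imax i0 isT); rewrite mulr_gt0 // normr_gt0.
have yK j : `|y 0 j| <= K * h 0 j by rewrite -ler_pdivrMr //; apply: imax.
have yi : `|y 0 i| = K * h 0 i by rewrite divfK // lt0r_neq0.
rewrite -(ler_pM2r (x := `|y 0 i|)); last by rewrite yi mulr_gt0.
rewrite -normrM.
have -> : w * y 0 i = (y *m N) 0 i by rewrite yN mxE.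
have -> : mu * `|y 0 i| = \sum_j K * h 0 j * N j i.
  under eq_bigr do rewrite -mulrA.
  rewrite -mulr_sumr yi mulrCA; congr (_ * _).
  by have /rowP/(_ i) := hN; rewrite !mxE => ->.
rewrite mxE; apply: le_trans (ler_norm_sum _ _ _) _.
by apply: ler_sum => j _; rewrite normrM (ger0_norm (N0 _ _)) ler_wpM2r.
Qed.

(** If the row [j0] of [B ^+ n] is at least [1], a suitable multiple of [h] can
    be subtracted from it without making an entry negative.  The new matrix [N]
    has eigenvalue [mu < lam ^+ n] at [h].  It differs from [B ^+ n] by a matrix
    with image on the line of [h], so a correction of [x] along [h] is an
    eigenvector of [N] for [z ^+ n]; hence [`|z| ^+ n <= mu]. *)
Lemma subdominant_eigenvalue (F : numFieldType) k (B : 'M[F]_k) (h x : 'rV_k)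
    (lam z : F) n (j0 : 'I_k) :
  (forall j i, 0 <= (B ^+ n) j i) -> (forall i, 1 <= (B ^+ n) j0 i) ->
  (forall i, 0 < h 0 i) -> 0 < lam -> h *m B = lam *: h ->
  x *m B = z *: x -> x != 0 -> z != lam -> `|z| < lam.
Proof.
move=> B0 Bj0 h0 lam0 hB xB x0 zlam.
pose d := (\sum_i h 0 i)^-1.
have S0 : 0 < \sum_i h 0 i.
  rewrite (bigD1 j0) //= ltr_pwDl // sumr_ge0 // => i _; exact: ltW.
have d0 : 0 < d by rewrite invr_gt0.
have dh i : d * h 0 i <= 1.
  rewrite mulrC ler_pdivrMr // mul1r (bigD1 i) //= lerDl sumr_ge0 // => j _.
  exact: ltW.
pose N : 'M[F]_k := \matrix_(j, i) ((B ^+ n) j i - (d * h 0 i) *+ (j == j0)).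
have NE (y : 'rV_k) : y *m N = y *m B ^+ n - (d * y 0 j0) *: h.
  apply/rowP => i; rewrite !mxE.
  under eq_bigr do rewrite mxE mulrBr.
  rewrite sumrB; congr (_ - _); rewrite (bigD1 j0) //= eqxx mulr1n big1 ?addr0.
    by rewrite mulrA [y _ _ * _]mulrC.
  by move=> j /negPf ->; rewrite mulr0n mulr0.
have N0 j i : 0 <= N j i.
  rewrite mxE subr_ge0; case: eqP => [->|_]; last by rewrite mulr0n.
  by rewrite mulr1n (le_trans (dh i)).
pose mu := lam ^+ n - d * h 0 j0.
have hN : h *m N = mu *: h by rewrite NE (eigen_expmx _ hB) -scalerBl.
have mu_lt : mu < lam ^+ n by rewrite ltrBlDr ltrDl mulr_gt0.
have mu0 : 0 <= mu.
  rewrite -(pmulr_lge0 _ (h0 j0)); have /rowP/(_ j0) := hN.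
  rewrite !mxE => <-; apply: sumr_ge0 => j _; rewrite mulr_ge0 //; exact: ltW.
suff zmu : `|z ^+ n| <= mu.
  have := le_lt_trans zmu mu_lt.
  case: n {B0 Bj0 N NE N0 mu hN mu_lt mu0 zmu} => [|n].
    by rewrite normr1 ltxx.
  by rewrite normrX ltr_pXn2r // nnegrE // ltW.
(* If z ^+ n = mu the correction c below is undefined, but then there is nothing
   left to bound. *)
have [zE|zmu] := eqVneq (z ^+ n) mu; first by rewrite zE ger0_norm.
pose c := d * x 0 j0 / (mu - z ^+ n).
have cE : c * (mu - z ^+ n) = d * x 0 j0 by rewrite divfK // subr_eq0 eq_sym.
apply: (@eigen_norm_le _ _ N h (x + c *: h)) => //.
  rewrite mulmxDl -scalemxAl hN NE (eigen_expmx _ xB) scalerDr -!addrA.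
  congr (_ + _); rewrite -scaleNr !scalerA -scalerDl; congr (_ *: _).
  by rewrite -cE mulrBr opprB subrK mulrC.
apply: contra_neq zlam => /eqP; rewrite addr_eq0 => /eqP xE.
have : (z - lam) *: x = 0.
  rewrite scalerBl -xB {1}xE mulNmx -scalemxAl hB scalerA [c * _]mulrC -scalerA.
  by rewrite -opprD -scalerDr [X in _ + X]xE subrr scaler0 oppr0.
by move/eqP; rewrite scaler_eq0 (negPf x0) orbF subr_eq0 => /eqP.
Qed.

(** Up to the factor [C], the sequence is submultiplicative and
    supermultiplicative, so each [l]-th root of [b l / C] is at most each [m]-th
    root of [C * b m]: compare both with [b (l * m)].  Any number between these
    two families will do; here it is the supremum of the first. *)
Lemma growth_constant (R : realType) (b : nat -> R) (C : R) :
  (forall l, 0 < b l) -> (forall l m, b (l + m)%N <= C * (b l * b m)) ->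
  (forall l m, b l * b m <= C * b (l + m)%N) -> 1 <= C ->
  exists2 lam : R, 0 < lam &
    forall l, b l <= C * lam ^+ l /\ lam ^+ l <= C * b l.
Proof.
move=> b0 subm supm C1; have C0 : 0 < C by apply: lt_le_trans C1.
have bC0 l : 0 < b l / C by rewrite divr_gt0.
have Cb0 l : 0 < C * b l by rewrite mulr_gt0.
have subX l m : b (l * m.+1)%N <= C ^+ m * b l ^+ m.+1.
  elim: m => [|m IH]; first by rewrite muln1 mul1r.
  rewrite mulnS (le_trans (subm _ _)) // [C ^+ m.+1]exprS -mulrA ler_pM2l //.
  by rewrite [b l ^+ _]exprS mulrCA ler_pM2l.
have supX l m : b l ^+ m.+1 <= C ^+ m * b (l * m.+1)%N.
  elim: m => [|m IH]; first by rewrite muln1 mul1r.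
  rewrite exprS; apply: (@le_trans _ _ (b l * (C ^+ m * b (l * m.+1)%N))).
    by rewrite ler_pM2l.
  rewrite mulrCA exprSr -mulrA ler_pM2l ?exprn_gt0 //.
  by rewrite [(l * m.+2)%N]mulnS; apply: supm.
have cross l m : (b l.+1 / C) ^+ m.+1 <= (C * b m.+1) ^+ l.+1.
  rewrite exprMn exprVn ler_pdivrMr ?exprn_gt0 //.
  apply: le_trans (supX _ _) _; rewrite mulnC [leRHS]mulrC.
  apply: ler_pM; rewrite ?exprn_ge0 ?(ltW (b0 _)) ?(ltW C0) //.
    by rewrite exprS ler_peMl // exprn_ge0 // ltW.
  apply: le_trans (subX _ _) _; rewrite exprMn ler_pM2r ?exprn_gt0 //.
  by rewrite exprS ler_peMl // exprn_ge0 // ltW.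
pose root (x : R) l := x `^ (l.+1%:R^-1).
have rootK x l : 0 < x -> root x l ^+ l.+1 = x.
  by move=> x0; rewrite -powR_mulrn ?powR_ge0 // -powRrM mulVf // powRr1 // ltW.
have root0 x l : 0 < x -> 0 < root x l by move=> x0; apply: powR_gt0.
have root_le l m : root (b l.+1 / C) l <= root (C * b m.+1) m.
  rewrite -(@ler_pXn2r _ (l.+1 * m.+1)) ?nnegrE ?(ltW (root0 _ _ _)) //.
  by rewrite exprM rootK // mulnC exprM rootK.
pose E : set R := range (fun l => root (b l.+1 / C) l).
have E0 : E !=set0 by exists (root (b 1%N / C) 0%N); exists 0%N.
have Eub m : ubound E (root (C * b m.+1) m) by move=> _ [l _ <-].
have rl l : root (b l.+1 / C) l <= sup E.
  by apply: ub_le_sup; [exists (root (C * b 1%N) 0%N)| exists l].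
have lam0 : 0 < sup E by apply: lt_le_trans (rl 0%N); apply: root0.
exists (sup E) => // -[|l].
  rewrite expr0 mulr1; split.
    by rewrite -(ler_pM2r (b0 0%N)); have := supm 0%N 0%N; rewrite addn0.
  by rewrite -(ler_pM2r (b0 0%N)) mul1r -mulrA; have := subm 0%N 0%N.
split.
  rewrite mulrC -ler_pdivrMr // -(rootK _ l (bC0 _)) ler_pXn2r ?nnegrE //.
    exact: ltW (root0 _ _ _).
  exact: ltW.
have lamr := ge_sup E0 (Eub l).
rewrite -(rootK _ l (Cb0 _)) ler_pXn2r ?nnegrE //; first exact: ltW.
exact: ltW (root0 _ _ _).
Qed.

Lemma growth_root_cvg (R : realType) (b : nat -> R) (C lam : R) :
  0 < lam -> 1 <= C -> (forall l, 0 < b l) ->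
  (forall l, b l <= C * lam ^+ l /\ lam ^+ l <= C * b l) ->
  limn_sup (fun l => b l `^ (l%:R^-1)) = lam.
Proof.
move=> lam0 C1 b0 bd; have C0 : 0 < C by apply: lt_le_trans C1.
suff cv : (fun l => b l `^ (l%:R^-1)) @ \oo --> lam.
  rewrite cvg_limn_supE; last by apply/cvg_ex; exists lam.
  exact/cvg_lim.
have root_cvg (c : R) : 0 < c ->
    (fun l => (c * lam ^+ l) `^ (l%:R^-1)) @ \oo --> lam.
  move=> c0; apply: (@cvg_trans _
    ((fun l : nat => expR (l%:R^-1 * ln c) * lam) @ \oo)).
    apply: near_eq_cvg; near=> l; have l0 : (0 < l)%N by near: l; exists 1%N.
    rewrite powRM ?exprn_ge0 ?(ltW c0) ?(ltW lam0) //.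
    rewrite -powR_mulrn ?(ltW lam0) // -powRrM divff ?pnatr_eq0 -?lt0n //.
    rewrite powRr1 ?ltW //.
    by rewrite /powR gt_eqF.
  rewrite -{2}(mul1r lam); apply: cvgMr_tmp.
  have pos : \forall l \near \oo, 0 < (l%:R : R).
    by near=> l; rewrite ltr0n; near: l; exists 1%N.
  have to0 : (fun l : nat => l%:R^-1 * ln c) @ \oo --> (0 : R).
    rewrite -(mul0r (ln c)); apply: cvgMr_tmp.
    by apply/(gtr0_cvgV0 pos); apply: cvgr_idn.
  have := cvg_comp _ _ to0 (@continuous_expR R 0).
  by rewrite expR0.
have Ci0 : 0 < C^-1 by rewrite invr_gt0.
apply: (squeeze_cvgr _ (root_cvg _ Ci0) (root_cvg _ C0)).
near=> l; have [bl lb] := bd l.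
have lam_ge l' : 0 <= lam ^+ l' by rewrite exprn_ge0 // ltW.
rewrite !ge0_ler_powR ?nnegrE ?invr_ge0 ?ler0n ?mulr_ge0 ?invr_ge0 ?(ltW C0)
  ?(ltW (b0 _)) //.
by rewrite mulrC ler_pdivrMr // mulrC.
Unshelve. all: by end_near. Qed.

(** Limits along an ultrafilter of indices exist for all bounded sequences at
    once, which spares the extraction of a common subsequence for the
    coordinates of a vector. *)
Lemma ultra_bounded_cvg (R : realType) (U : set_system nat) (u : nat -> R) a D :
  UltraFilter U -> (forall l, a <= u l <= D) ->
  exists2 p, a <= p <= D & u @ U --> p.
Proof.
move=> UU uaD; have UP : ProperFilter U by exact: ultra_proper.
have [|p [pI clp]] := @segment_compact R a D (u @ U) _.
  suff : U (u @^-1` `[a, D]) by [].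
  by apply: filterS filterT => l _; rewrite /= in_itv /=; apply: uaD.
exists p; first by move: pI; rewrite /= in_itv.
move=> B pB; have [//|UnB] := in_ultra_setVsetC (u @^-1` B) UU.
by have [q [/= nBq Bq]] := clp (~` B) B UnB pB.
Qed.

(** The normalised vectors [g l] need not converge, but [B] sends [g l] to
    [lam *: g l.+1], so it multiplies their Cesaro means [A L] by [lam] up to an
    error of order [1 / L].  Every limit point of these means is thus an
    eigenvector, and it is positive since its entries are at least [a]. *)
Lemma positive_eigenvector (R : realType) k (B : 'M[R]_k) (a D lam : R) :
  0 < a -> 0 < lam ->
  (forall i l,
    a * lam ^+ l <= ((const_mx 1 : 'rV_k) *m B ^+ l) ord0 i <= D * lam ^+ l) ->
  exists2 h : 'rV[R]_k, forall i, 0 < h ord0 i & h *m B = lam *: h.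
Proof.
move=> a0 lam0 bd.
pose g l : 'rV[R]_k := (lam ^- l) *: (const_mx 1 *m B ^+ l).
have gb i l : a <= g l ord0 i <= D.
  by rewrite mxE mulrC ler_pdivlMr ?ler_pdivrMr ?exprn_gt0.
have gB l : g l *m B = lam *: g l.+1.
  rewrite -scalemxAl -mulmxA mulmxE -exprSr scalerA; congr (_ *: _).
  by rewrite exprS invfM mulrA divff ?gt_eqF // mul1r.
pose A L : 'rV[R]_k := (L.+1%:R)^-1 *: \sum_(m < L.+1) g m.
have Ab i L : a <= A L ord0 i <= D.
  rewrite mxE mulrC ler_pdivlMr ?ler_pdivrMr ?ltr0n // summxE.
  have cst c : c * L.+1%:R = \sum_(m < L.+1) c.
    by rewrite sumr_const card_ord mulr_natr.
  rewrite !cst; apply/andP; split; apply: ler_sum => m _.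
    by have /andP[] := gb i m.
  by have /andP[] := gb i m.
have AB L : A L *m B = lam *: A L + (lam / L.+1%:R) *: (g L.+1 - g 0%N).
  rewrite -scalemxAl mulmx_suml.
  under eq_bigr do rewrite gB.
  rewrite -scaler_sumr !scalerA [lam / _]mulrC -scalerDr; congr (_ *: _).
  rewrite big_ord_recr [in RHS]big_ord_recl /= [RHS]addrC addrA subrK addrC.
  by [].
have [U [UU leU]] := ultraFilterLemma (@eventually_filter).
have UP : ProperFilter U by exact: ultra_proper.
have lims i : exists p : R, 0 < p /\ (fun L => A L ord0 i) @ U --> p.
  have [p /andP[ap _] pU] := ultra_bounded_cvg UU (Ab i).
  by exists p; split => //; apply: lt_le_trans ap.
have [h hP] := choice lims.
exists (\row_i h i) => [i|]; first by rewrite mxE; have [] := hP i.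
apply/rowP => i; rewrite !mxE.
apply: (@cvg_unique _ (@norm_hausdorff _ R) ((fun L => (A L *m B) ord0 i) @ U)).
  rewrite (_ : (fun L => _) = (fun L => \sum_j A L ord0 j * B j i)); last first.
    by apply/funext => L; rewrite mxE.
  apply: cvg_big => [|j _]; first exact: add_continuous.
  by rewrite mxE; apply: cvgMr_tmp; have [] := hP j.
rewrite (_ : (fun L => _) = (fun L => lam * A L ord0 i +
    (lam * (g L.+1 - g 0%N) ord0 i) * L.+1%:R^-1)); last first.
  by apply/funext => L; rewrite AB 2!mxE [in X in _ + X]mxE mulrAC.
rewrite -[lam * _]addr0.
apply: cvgD; first by apply: cvgMl_tmp; have [] := hP i.
apply: (cvg_trans (cvg_app _ leU)); rewrite /=.
have harm c : (fun L => c * L.+1%:R^-1) @ \oo --> (0 : R).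
  by rewrite -[0](mulr0 c); apply: cvgMl_tmp; apply: cvg_harmonic.
apply: (squeeze_cvgr _ (harm (- (lam * (D - a)))) (harm (lam * (D - a)))).
apply: nearW => L; rewrite !ler_pM2r ?invr_gt0 ?ltr0n // -mulrN !ler_pM2l //.
have /andP[] := gb i L.+1; have /andP[] := gb i 0%N; rewrite !mxE; lra.
Qed.

(** The minimal polynomial of [x] divides [q] over the rationals: the remainder
    vanishes at [x] and has smaller degree. *)
Lemma conjugate_root (R : realType) (x : R) (z : R[i]) (q : {poly int}) :
  root (map_poly intr q) x -> galois_conjugate x z -> root (map_poly intr q) z.
Proof.
move=> qx [p [pm px pmin] pz].
have ratr_intr (F : numFieldType) (s : {poly int}) :
    map_poly (ratr : rat -> F) (map_poly intr s) = map_poly intr s.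
  by rewrite -map_poly_comp; apply: eq_map_poly => a /=; rewrite ratr_int.
have p0 : p != 0 by apply: monic_neq0.
set q' := map_poly (intr : int -> rat) q.
have q'E (F : numFieldType) : map_poly intr q =
    map_poly (ratr : rat -> F) (q' %/ p) * map_poly ratr p
    + map_poly ratr (q' %% p).
  by rewrite -rmorphM -rmorphD -divp_eq; apply: esym (ratr_intr F q).
have r0 : q' %% p = 0.
  apply/eqP; apply: contraT => r0.
  have : (size p <= size (q' %% p)%R)%N.
    apply: pmin => //; move: qx; rewrite q'E rootE hornerD hornerM.
    by rewrite (rootP px) mulr0 add0r.
  by rewrite leqNgt ltn_modpN0.
by rewrite q'E r0 rmorph0 addr0 rootM pz orbT.
Qed.

(** * Growth of the powers of a natural number matrix *)
Section NatMatrix.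
Variables (k : nat) (A : 'M[nat]_k).

Definition natmx (F : pzSemiRingType) : 'M[F]_k := map_mx (fun n => n%:R) A.

Lemma natmxX (F : pzSemiRingType) l :
  natmx F ^+ l = map_mx (fun n => n%:R) (A ^+ l).
Proof.
elim: l => [|l IH].
  by rewrite !expr0; apply/matrixP => i j; rewrite !mxE; case: (_ == _).
rewrite !exprS IH; apply/matrixP => i j; rewrite !mxE natr_sum.
by apply: eq_bigr => a _; rewrite !mxE natrM.
Qed.

(** If [A j i] counts the edges from [i] to [j], this is the number of paths of
    length [l] that start at [i].  Columns, not rows, are the sources because
    eigenvectors are row vectors. *)
Definition colsum l (i : 'I_k) : nat := (\sum_j (A ^+ l) j i)%N.

Lemma colsum_mx (F : pzSemiRingType) l i :
  ((const_mx 1 : 'rV[F]_k) *m natmx F ^+ l) ord0 i = (colsum l i)%:R.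
Proof.
rewrite mxE natr_sum; apply: eq_bigr => j _.
by rewrite natmxX !mxE mul1r.
Qed.

Lemma colsumD l m i :
  colsum (l + m) i = (\sum_j colsum l j * (A ^+ m) j i)%N.
Proof.
rewrite /colsum exprD; under eq_bigr do rewrite mxE.
rewrite exchange_big; apply: eq_bigr => j _ /=.
by rewrite big_distrl.
Qed.

Definition char_polyZ : {poly int} := char_poly (natmx int).

Lemma map_char_polyZ (F : nzRingType) :
  map_poly (intr : int -> F) char_polyZ = char_poly (natmx F).
Proof.
rewrite map_char_poly; congr char_poly; apply/matrixP => i j.
by rewrite !mxE rmorph_nat.
Qed.

Lemma natmx_eigenvalue (F : fieldType) (z : F) :
  root (map_poly (intr : int -> F) char_polyZ) z ->
  exists2 x : 'rV_k, x *m natmx F = z *: x & x != 0.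
Proof. by rewrite map_char_polyZ -eigenvalue_root_char => /eigenvalueP. Qed.

(** The comparability of the column sums stands in for irreducibility, and the
    positive row of [A ^+ n] for primitivity. *)
Theorem perron_colsum_growth (R : realType) (C n : nat) (i0 j0 : 'I_k) :
  (forall l i, 0 < colsum l i)%N ->
  (forall l i j, colsum l i <= C * colsum l j)%N ->
  (forall i, 0 < (A ^+ n) j0 i)%N ->
  let lam : R := limn_sup (fun l => (colsum l i0)%:R `^ (l%:R^-1)) in
  lam = 1 \/ perron_number lam.
Proof.
move=> c0 cC Aj0.
pose b l : R := (colsum l i0)%:R.
have b0 l : 0 < b l by rewrite ltr0n.
have C1 : 1 <= C%:R :> R.
  rewrite ler1n; have := cC 0%N i0 i0; have := c0 0%N i0.
  by case: C {cC} => //; case: (colsum _ _).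
have sub l m : b (l + m)%N <= C%:R * (b l * b m).
  rewrite -!natrM ler_nat colsumD {3}/colsum !big_distrr leq_sum //= => j _.
  by rewrite mulnA leq_mul2r cC orbT.
have sup l m : b l * b m <= C%:R * b (l + m)%N.
  rewrite -!natrM ler_nat colsumD {2}/colsum !big_distrr leq_sum //= => j _.
  by rewrite mulnA leq_mul2r cC orbT.
have [lam lam0 bd] := growth_constant b0 sub sup C1.
rewrite (growth_root_cvg lam0 C1 b0 bd) /=.
have C0 : 0 < C%:R :> R by apply: lt_le_trans C1.
(* Otherwise the positive integers b l would tend to 0. *)
have lam1 : 1 <= lam.
  rewrite leNgt; apply/negP => lam1.
  have /cvgr_lt/(_ (C%:R^-1)) : (fun l => lam ^+ l) @ \oo --> (0 : R).
    by apply: cvg_expr; rewrite gtr0_norm.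
  rewrite invr_gt0 => /(_ C0) [N _ /(_ N (leqnn N)) /=].
  rewrite -[ltRHS]mul1r ltr_pdivlMr // mulrC => /(le_lt_trans (bd N).1).
  by rewrite ltrn1 ltnNge c0.
have [h h0 hB] : exists2 h : 'rV[R]_k,
    forall i, 0 < h ord0 i & h *m natmx R = lam *: h.
  apply: (@positive_eigenvector _ _ _ (C%:R^-2) (C%:R ^+ 2)) => // [|i l].
    by rewrite invr_gt0 exprn_gt0.
  have [b1 b2] := bd l; rewrite colsum_mx.
  have c1 : (colsum l i)%:R <= C%:R * b l by rewrite -natrM ler_nat cC.
  have c2 : b l <= C%:R * (colsum l i)%:R by rewrite -natrM ler_nat cC.
  apply/andP; split; last first.
    by apply: le_trans c1 _; rewrite expr2 -mulrA ler_pM2l.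
  rewrite mulrC ler_pdivrMr ?exprn_gt0 // (le_trans b2) //.
  by rewrite expr2 mulrA [leRHS]mulrC ler_pM2l // mulrC.
have lamroot : root (map_poly intr char_polyZ) lam.
  rewrite map_char_polyZ -eigenvalue_root_char.
  apply/eigenvalueP; exists h => //.
  by apply: contraTneq (h0 i0) => ->; rewrite mxE ltxx.
have [->|lamN1] := eqVneq lam 1; [by left|right].
split; first by rewrite lt_neqAle eq_sym lamN1.
  by exists char_polyZ; first exact: char_poly_monic.
move=> z /(conjugate_root lamroot)/natmx_eigenvalue[x xB x0] zlam.
rewrite [ltRHS]gtr0_norm; last by rewrite ltcR.
apply: (@subdominant_eigenvalue R[i] _ (natmx R[i])
  (map_mx (real_complex R) h) x _ _ n j0) => //.
- by move=> j i; rewrite natmxX mxE.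
- by move=> i; rewrite natmxX mxE ler1n.
- by move=> i; rewrite mxE ltcR.
- by rewrite ltcR.
- have -> : natmx R[i] = map_mx (real_complex R) (natmx R).
    by apply/matrixP => i j; rewrite !mxE rmorph_nat.
  by rewrite -map_mxM hB map_mxZ.
Qed.
End NatMatrix.

(** * The automaton of geodesics *)
Section TransferMatrix.
Variables (V : finType) (e : rel V).
Hypothesis e_irr : irreflexive e.
Implicit Types s t : {set V}.

Local Notation step := (step e).
Local Notation num_words := (num_words e).

Lemma stepS s t v : s \subset t -> step s v \subset step t v.
Proof. by move=> st; apply: finset.setUS; apply: finset.setSI. Qed.

(** A larger state stays larger, and it allows fewer signs at each step. *)
Lemma num_words_antimono s t l :
  s \subset t -> (num_words t l <= num_words s l)%N.
Proof.
elim: l s t => //= l IH s t st; apply: leq_sum => v _.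
apply: leq_mul; last by apply/IH/stepS.
by rewrite /weight; case: ifP; case: ifP => // /(fintype.subsetP st) ->.
Qed.

(** Each vertex of [t] missing from [s] costs at most one factor of 2, for the
    choice of its sign at its first occurrence: after it, or once a letter that
    does not commute with it has been read, the vertex belongs to both states or
    to neither. *)
Lemma num_words_enlarge s t l : s \subset t ->
  (num_words s l <= 2 ^ #|t :\: s| * num_words t l)%N.
Proof.
elim: l s t => [|l IH] s t st /=; first by rewrite muln1 expn_gt0.
rewrite big_distrr; apply: leq_sum => v _ /=.
have le_step := IH _ _ (stepS v st).
have subD : step t v :\: step s v \subset (t :\: s) :\ v.
  apply/fintype.subsetP => u; rewrite !inE.
  by case: (u == v); case: (u \in s); case: (u \in t); case: (e v u).
have cardD := subset_leq_card subD.
rewrite mulnA; rewrite (cardsD1 v (t :\: s)) inE in cardD *.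
apply: (@leq_trans
  (weight s v * (2 ^ #|(t :\: s) :\ v| * num_words (step t v) l))).
  rewrite leq_mul2l; apply/orP; right; apply: leq_trans le_step _.
  by rewrite leq_mul2r leq_pexp2l ?orbT //; apply: subset_leq_card.
rewrite mulnA leq_mul2r; apply/orP; right; rewrite expnD mulnAC leq_mul2r.
apply/orP; right; rewrite /weight.
by case: (boolP (v \in s)) => [/(fintype.subsetP st) ->|_]; case: (v \in t).
Qed.

(** All counts lie between those of the full and of the empty set, even though
    the full set need not be a state reached by a word. *)
Lemma num_words_comparable s t l :
  (num_words s l <= 2 ^ #|V| * num_words t l)%N.
Proof.
apply: (@leq_trans (num_words finset.set0 l)).
  exact/num_words_antimono/finset.sub0set.
apply: leq_trans (num_words_enlarge l (finset.subsetT finset.set0)) _.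
rewrite finset.setD0 cardsT leq_mul2l num_words_antimono ?orbT //.
Qed.

Lemma num_words_gt0 s l : (0 < #|V|)%N -> (0 < num_words s l)%N.
Proof.
case/card_gt0P => v _; elim: l s => //= l IH s.
rewrite (bigD1 v) //= addn_gt0 muln_gt0 IH andbT.
by rewrite /weight; case: ifP.
Qed.

(** A vertex of [s] survives in the state as long as it commutes with all the
    letters read; apart from this the state depends on the word only. *)
Lemma foldl_step s w : foldl step s w =
  foldl step finset.set0 w :|: [set u in s | all (e^~ u) w].
Proof.
elim: w s => [|v w IH] s /=.
  by apply/setP => u; rewrite !inE andbT.
rewrite IH [in RHS]IH; apply/setP => u; rewrite !inE /= orbF.
by rewrite -orbA andb_orl -andbA.
Qed.

(** No vertex is adjacent to itself, so none survives a word in which every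
    vertex occurs. *)
Lemma enum_synchronizes s :
  foldl step s (enum V) = foldl step finset.set0 (enum V).
Proof.
rewrite foldl_step (_ : [set u in s | _] = finset.set0) ?finset.setU0 //.
apply/setP => u; rewrite !inE; apply/negP => /andP[_ /allP/(_ u)].
by rewrite mem_enum e_irr => /(_ isT).
Qed.

Definition transfer : 'M[nat]_(#|{set V}|) :=
  \matrix_(j, i)
    \sum_(v | step (enum_val i) v == enum_val j) weight (enum_val i) v.

Lemma colsum_transfer l i :
  colsum transfer l i = num_words (enum_val i) l.
Proof.
elim: l i => [|l IH] i.
  rewrite /colsum expr0 (bigD1 i) //= mxE eqxx big1 // => j /negPf ji.
  by rewrite mxE ji.
rewrite -addn1 colsumD expr1 addn1 /=.
under eq_bigr do rewrite IH mxE big_mkcond big_distrr /=.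
rewrite exchange_big; apply: eq_bigr => v _ /=.
rewrite (bigD1 (enum_rank (step (enum_val i) v))) //= enum_rankK eqxx mulnC.
rewrite big1 ?addn0 // => j; rewrite -(inj_eq enum_val_inj) enum_rankK eq_sym.
by move=> /negPf ->; rewrite muln0.
Qed.

(** With [enum_synchronizes] this gives the positive row. *)
Lemma transfer_path s w :
  (0 < (transfer ^+ size w) (enum_rank (foldl step s w)) (enum_rank s))%N.
Proof.
elim: w s => [|v w IH] s /=; first by rewrite expr0 mxE eqxx.
rewrite exprSr mxE (bigD1 (enum_rank (step s v))) //=.
rewrite ltn_addr // muln_gt0 IH mxE !enum_rankK (bigD1 v) //=.
by rewrite addn_gt0 /weight; case: ifP.
Qed.

End TransferMatrix.

Theorem theoremD (R : realType) (V : finType) (e : rel V)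
    (e_sym : symmetric e) (e_irr : irreflexive e) (V_gt0 : (0 < #|V|)%N) :
  geodesic_growth_rate (@raag_gens V e) R = 1%R \/
  perron_number (geodesic_growth_rate (@raag_gens V e) R).
Proof.
pose sync := enum_rank (foldl (step e) finset.set0 (enum V)).
have -> : geodesic_growth_rate (@raag_gens V e) R =
    limn_sup (fun l =>
      (colsum (transfer e) l (enum_rank finset.set0))%:R `^ l%:R^-1).
  congr limn_sup; apply/funext => l.
  by rewrite (num_geodesicsE e_sym e_irr) colsum_transfer enum_rankK.
apply: (@perron_colsum_growth _ (transfer e) R
  (2 ^ #|V|) (size (enum V)) _ sync).
- by move=> l s; rewrite colsum_transfer num_words_gt0.
- by move=> l s t; rewrite !colsum_transfer num_words_comparable.
- move=> s; rewrite /sync -(enum_synchronizes e_irr (enum_val s)).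
  by rewrite -{2}(enum_valK s); apply: transfer_path.
Qed.
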